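(* Let $N$ be a positive integer and let $\{\pi(i); i=0,1,\dots,N\}$ be a probability distribution with $\min_{0\le i\le N}\pi(i)>0$. Let $T_{\rm D}$ be the running time (number of uniform random variables used) of the Doubling-MBD sampler for $\pi$, and let $\theta$ be the positive constant, both as defined in the context. Then $$\mathsf{E}[T_{\rm D}]\le4\theta N,$$ $$\mathsf{P}(T_{\rm D}>k\theta N)\le\exp\{1-k/(4e)\}\qquad\text{for all integers }k\ge0.$$
   Context: Let $\gamma(i)=\pi(i)/\pi(i+1)$ for $0\le i\le N-1$. Define $p_0=\frac{1}{1+\gamma(0)}$, $p_i=\frac{1}{1+\max(\gamma(i),\gamma(i-1))}$ for $1\le i\le N-1$, $p_N=0$; and $q_0=0$, $q_1=\frac{\gamma(0)}{1+\gamma(0)}$, $q_i=\frac{\gamma(i-1)}{1+\max(\gamma(i-1),\gamma(i-2))}$ for $2\le i\le N$. Define $$\theta=\min\left\{\max_{0\le i\le N-1}\left(\frac{1}{p_i}\sum_{m=0}^{i}\frac{\pi(m)}{\pi(i)}\right),\ \max_{0\le i\le N-1}\left(\frac{1}{p_i}\sum_{m=i+1}^{N}\frac{\pi(m)}{\pi(i)}\right)\right\}.$$ Define $\phi:\{0,\dots,N\}\times(0,1)\to\{0,\dots,N\}$ by $\phi(i,u)=i+1$ if $u\in(1-p_i,1)$, $\phi(i,u)=i$ if $u\in[q_i,1-p_i]$, and $\phi(i,u)=i-1$ if $u\in(0,q_i)$. Let $\{U_m;m\in\mathbb{Z}\}$ be i.i.d. random variables uniform on $(0,1)$. For $m\in\mathbb{Z}$,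 an integer $n\ge0$ and $x\in\{0,\dots,N\}$, let $$\Phi(x;U_m,\dots,U_{m+n-1})=\phi(\phi(\cdots\phi(x,U_m),\dots,U_{m+n-2}),U_{m+n-1}),$$ i.e. $U_m$ is applied first and $U_{m+n-1}$ last (and the value is $x$ if $n=0$). The Doubling-MBD sampler is the following algorithm. (i) Set $t=2$. (ii) Double $t$ until $Y:=\Phi(0;U_{-t},\dots,U_{-t/2-1})=\Phi(N;U_{-t},\dots,U_{-t/2-1})$ (so the chain is run from time $-t$ to time $-t/2$). (iii) Return $\Phi(Y;U_{-t/2},\dots,U_{-1})$. Its running time $T_{\rm D}$ is the number of uniform random variables it uses, i.e. $$T_{\rm D}=\inf\{t\in\{2,4,8,16,\dots\}:\ \Phi(0;U_{-t},\dots,U_{-t/2-1})=\Phi(N;U_{-t},\dots,U_{-t/2-1})\}.$$ *)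

(* Defs.v *)
From HB Require Import structures.
From mathcomp Require Import all_boot all_order all_algebra.
From mathcomp Require Import all_classical all_reals all_analysis.

Set Implicit Arguments.
Unset Strict Implicit.
Unset Printing Implicit Defensive.

Import Order.TTheory GRing.Theory Num.Theory.
Import numFieldNormedType.Exports.

Local Open Scope classical_set_scope.
Local Open Scope ring_scope.

Section MBD.
Context {R : realType} {N : nat}.
Variable pi : 'I_N.+1 -> R.

(* Meaningful for i < N only, as [inord] sends out-of-range values to 0. *)
Definition gamma (i : nat) : R := pi (inord i) / pi (inord i.+1).

Definition p_up (i : nat) : R :=
  if i == N then 0
  else if i == 0%N then 1 / (1 + gamma 0)
  else 1 / (1 + Num.max (gamma i) (gamma i.-1)).

Definition q_down (i : nat) : R :=
  if i == 0%N then 0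
  else if i == 1%N then gamma 0 / (1 + gamma 0)
  else gamma i.-1 / (1 + Num.max (gamma i.-1) (gamma i.-2)).

(* The unit 0 of the two maxima is harmless: the ranges are nonempty for N > 0
   and the terms are nonnegative when pi is. *)
Definition theta : R :=
  Num.min
    (\big[Num.max/0]_(i < N.+1 | (i < N)%N)
       (1 / p_up i * \sum_(m < N.+1 | (m <= i)%N) pi m / pi i))
    (\big[Num.max/0]_(i < N.+1 | (i < N)%N)
       (1 / p_up i * \sum_(m < N.+1 | (i < m)%N) pi m / pi i)).

(* The last branch is reached only for u outside ]0, 1[, an event of
   probability 0 for a uniform variable.  Since p_up N = 0 and q_down 0 = 0,
   the [inord]s do not overflow. *)
Definition phi (i : 'I_N.+1) (u : R) : 'I_N.+1 :=
  if u \in `](1 - p_up i), 1[ then inord i.+1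
  else if u \in `[q_down i, (1 - p_up i)] then i
  else if u \in `]0, (q_down i)[ then inord i.-1
  else i.

(* Phi x u m n is Phi(x; u_m, ..., u_(m+n-1)), with u_m applied first. *)
Definition Phi (x : 'I_N.+1) (u : int -> R) (m : int) (n : nat) : 'I_N.+1 :=
  foldl phi x [seq u (m + k%:Z) | k <- iota 0 n].

(* The indices -t, ..., -t/2-1 are t/2 in number. *)
Definition coalesces (u : int -> R) (t : nat) : Prop :=
  Phi ord0 u (- t%:Z) t./2 = Phi ord_max u (- t%:Z) t./2.

(* Equal to +oo if coalescence never occurs. *)
Definition T_D (u : int -> R) : \bar R :=
  ereal_inf [set (t%:R)%:E | t in
    [set t : nat | (exists j : nat, t = (2 ^ j.+1)%N) /\ coalesces u t]].

End MBD.

Definition mutually_independent d (T : measurableType d) (R : realType)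
    (P : probability T R) d' (T' : measurableType d') (I : choiceType)
    (X : I -> {RV P >-> T'}) : Prop :=
  forall (J : seq I) (A : I -> set T'), uniq J ->
    (forall i, i \in J -> measurable (A i)) ->
    P (\bigcap_(i in [set` J]) X i @^-1` A i) =
    (\prod_(i <- J) P (X i @^-1` A i))%E.

(* [uniform_prob] is the uniform law on [0, 1], i.e., that on ]0, 1[. *)
Definition iid_uniform01 d (T : measurableType d) (R : realType)
    (P : probability T R) (U : int -> {RV P >-> R}) : Prop :=
  mutually_independent U /\
  forall (m : int) (A : set R), measurable A ->
    distribution P (U m) A = uniform_prob (@ltr01 R) A.

(* Main.v *)
(* Since each u gives a monotone map x |-> phi x u, the copies started at 0 and
   N bracket all others.  Let f n be the probability that these two have not
   met after n steps.  They have met as soon as the lower one hits N, or the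
   upper one hits 0, and the mean hitting times of this birth-death chain are
   explicit sums of N terms; so sum_n f n <= theta N =: mu.

   T_D > 2^(j+1) forces the window of length 2^j to fail, which has
   probability f (2^j).  As f is nonincreasing, 2^(j-1) f (2^j) is at most the
   sum of f over ]2^(j-1), 2^j], whence E[T_D] <= 4 mu.  For the tail, f is
   submultiplicative, and f b <= 1/e for b = floor (e mu) by Markov's
   inequality, so f n <= exp (1 - n / (e mu)).

   As the set of maps of {0, ..., N} is finite, a window event is a finite
   disjoint union of product events, to which independence applies directly. *)

Require Import Defs.
From mathcomp Require Import all_boot all_order all_algebra.
From mathcomp Require Import all_classical all_reals all_analysis.
From mathcomp Require Import measurable_realfun.
From mathcomp Require Import ring lra zify.

Import Order.TTheory GRing.Theory Num.Theory.
Import numFieldNormedType.Exports.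

Local Open Scope classical_set_scope.
Local Open Scope ring_scope.

Set Implicit Arguments.
Unset Strict Implicit.
Unset Printing Implicit Defensive.

(** * Coalescence of two orbits under i.i.d. random monotone maps *)

Section NonCoalescence.
Context {R : realType} {N : nat}.
Local Notation S := 'I_N.+1.
Variable nu : {ffun S -> S} -> R.

(* Probability that the orbits of x and y under n independent random maps of
   law nu, the same for both, have not met. *)
Fixpoint noncoal (n : nat) (x y : S) : R :=
  if n is n'.+1 then \sum_g nu g * noncoal n' (g x) (g y)
  else (x != y)%:R.

Arguments noncoal : simpl never.

Lemma noncoal0 x y : noncoal 0 x y = (x != y)%:R. Proof. by []. Qed.

Lemma noncoalS n x y :
  noncoal n.+1 x y = \sum_g nu g * noncoal n (g x) (g y).
Proof. by []. Qed.

Hypothesis nu_ge0 : forall g, 0 <= nu g.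
Hypothesis nu_sum1 : \sum_g nu g = 1.
Hypothesis nu_mono : forall g, nu g != 0 -> {homo g : x y / (x <= y)%N}.

Lemma noncoal_ge0 n x y : 0 <= noncoal n x y.
Proof.
elim: n x y => [|n IH] x y; first exact: ler0n.
rewrite noncoalS.
by apply: sumr_ge0 => g _; apply: mulr_ge0.
Qed.

Lemma noncoalxx n x : noncoal n x x = 0.
Proof.
elim: n x => [|n IH] x; first by rewrite noncoal0 eqxx.
rewrite noncoalS.
by apply: big1 => g _; rewrite IH mulr0.
Qed.

Lemma noncoal_le1 n x y : noncoal n x y <= 1.
Proof.
elim: n x y => [|n IH] x y; first by rewrite noncoal0; case: eqP.
rewrite noncoalS.
rewrite -[leRHS]nu_sum1; apply: ler_sum => g _.
by rewrite ler_piMr.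
Qed.

(** Monotone maps keep the inner pair between the outer one, so once the outer orbits meet the inner
    ones are squeezed together. *)
Lemma noncoal_widen n (x1 x2 y2 y1 : S) :
  (x1 <= x2)%N -> (x2 <= y2)%N -> (y2 <= y1)%N ->
  noncoal n x2 y2 <= noncoal n x1 y1.
Proof.
elim: n x1 x2 y2 y1 => [|n IH] x1 x2 y2 y1 x12 xy y21.
  rewrite !noncoal0 ler_nat; case: (eqVneq x1 y1) => [e|];
    last by rewrite leq_b1.
  suff /eqP-> : x2 == y2 by rewrite eqxx.
  by rewrite -val_eqE eqn_leq xy (leq_trans y21)// -e.
rewrite !noncoalS; apply: ler_sum => g _.
have [->|g0] := eqVneq (nu g) 0; first by rewrite !mul0r.
by rewrite ler_wpM2l// IH// nu_mono.
Qed.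

(** A pair still apart after [n] steps lies between the two extreme states, so restarting from these
    can only raise the probability of staying apart. *)
Lemma noncoal_submult m n (x y : S) : (x <= y)%N ->
  noncoal (n + m) x y <= noncoal n x y * noncoal m ord0 ord_max.
Proof.
elim: n x y => [|n IH] x y xy.
  rewrite add0n noncoal0; have [->|_] := eqVneq x y.
    by rewrite noncoalxx mul0r.
  rewrite mul1r; apply: noncoal_widen; rewrite ?leq_ord //; exact: leq_ord.
rewrite addSn !noncoalS mulr_suml; apply: ler_sum => g _; rewrite -mulrA.
have [->|g0] := eqVneq (nu g) 0; first by rewrite !mul0r.
by rewrite ler_wpM2l// IH// nu_mono.
Qed.

Local Notation f n := (noncoal n ord0 ord_max).

Lemma noncoal_nincr m n : (m <= n)%N -> f n <= f m.
Proof.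
move=> mn; rewrite -(subnKC mn).
apply: le_trans (@noncoal_submult _ _ ord0 ord_max (leq0n N)) _.
by rewrite ler_piMr ?noncoal_ge0 ?noncoal_le1.
Qed.

Lemma noncoal_mul_le b k : f (k * b)%N <= f b ^+ k.
Proof.
elim: k => [|k IH]; first by rewrite mul0n expr0 noncoal_le1.
rewrite mulSn exprS.
apply: le_trans (@noncoal_submult _ _ ord0 ord_max (leq0n N)) _.
by rewrite ler_wpM2l// noncoal_ge0.
Qed.

(* Optional stopping for the Lyapunov function [h] along the pair. *)
Lemma sum_noncoal_le (h : S -> S -> R) :
  (forall x y, 0 <= h x y) ->
  (forall x y : S, (x < y)%N -> \sum_g nu g * h (g x) (g y) <= h x y - 1) ->
  forall M (x y : S), (x <= y)%N -> \sum_(n < M) noncoal n x y <= h x y.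
Proof.
move=> h0 hK; elim=> [|M IH] x y xy; first by rewrite big_ord0.
have [->|nxy] := eqVneq x y.
  by rewrite big1// => i _; rewrite noncoalxx.
have {}xy' : (x < y)%N by rewrite ltn_neqAle xy andbT.
(* The term [n = 0] equals 1 and is paid for by the unit drift of [h]; the induction hypothesis
   bounds the rest after one step. *)
rewrite big_ord_recl noncoal0 nxy exchange_big /=.
rewrite -lerBrDl; apply: le_trans (hK _ _ xy'); apply: ler_sum => g _.
rewrite -mulr_sumr; have [->|g0] := eqVneq (nu g) 0; first by rewrite !mul0r.
by rewrite ler_wpM2l// IH// nu_mono.
Qed.

Variable mu : R.
Hypothesis sum_le : forall M, \sum_(n < M) f n <= mu.

(** The left side is a truncated bound on the mean running time: 2 is the first value tried, and a
    failed window of length [2 ^ j] doubles [2 ^ j.+1], hence adds as much. *)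
Lemma sum_dyadic_noncoal J : (0 < N)%N ->
  2 + \sum_(j < J) 2 ^+ j.+1 * f (2 ^ j)%N <= 4 * mu.
Proof.
move=> N0.
have f00 : f 0%N = 1 by rewrite noncoal0 -val_eqE /= eq_sym -lt0n N0.
have mu1 : 1 <= mu by have := sum_le 1; rewrite big_ord_recl big_ord0 f00 addr0.
(* As [f 0 = 1], the correction [- 4 - 2 * f 1] makes the case [K = 0] an equality; the 4 later
   absorbs the leading 2. *)
have key K : \sum_(j < K.+1) 2 ^+ j.+1 * f (2 ^ j)%N <=
    4 * (\sum_(n < (2 ^ K).+1) f n) - 4 - 2 * f 1%N.
  elim: K => [|K IH].
    by rewrite expn0 !big_ord_recr !big_ord0 /= f00 expn0; nra.
  rewrite big_ord_recr.
  have -> : (2 ^ K.+1).+1 = ((2 ^ K).+1 + 2 ^ K)%N.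
    by rewrite expnS mul2n -addnn addSn.
  rewrite big_split_ord /=.
  (* [f] is nonincreasing on the dyadic block ]2^K, 2^(K+1)]. *)
  have : 2 ^+ K * f (2 ^ K.+1)%N <= \sum_(i < 2 ^ K) f ((2 ^ K).+1 + i)%N.
    apply: (@le_trans _ _ (\sum_(i < 2 ^ K) f (2 ^ K.+1)%N)).
      by rewrite sumr_const card_ord -[leRHS]mulr_natl natrX.
    apply: ler_sum => i _; apply: noncoal_nincr.
    by rewrite expnS mul2n -addnn addSn -addnS leq_add2l ltn_ord.
  rewrite /= in IH *.
  rewrite !exprS; lra.
case: J => [|J]; first by rewrite big_ord0; lra.
have := key J; have := sum_le (2 ^ J).+1; have := noncoal_ge0 1 ord0 ord_max.
lra.
Qed.

Lemma noncoal_expR n : (0 < N)%N ->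
  f n <= expR (1 - n%:R / (expR 1 * mu)).
Proof.
move=> N0.
have f00 : f 0%N = 1 by rewrite noncoal0 -val_eqE /= eq_sym -lt0n N0.
have mu1 : 1 <= mu by have := sum_le 1; rewrite big_ord_recl big_ord0 f00 addr0.
have e0 : 0 < expR 1 :> R := expR_gt0 _.
have e1 : 1 <= expR 1 :> R by rewrite ltW// expR_gt1.
pose b := Num.truncn (expR 1 * mu).
have emu1 : 1 <= expR 1 * mu by nra.
have /andP[bl bu] := truncn_itv (le_trans ler01 emu1).
have b0 : (0 < b)%N by rewrite truncn_gt0.
have fb : f b <= (expR 1)^-1.
  (* Markov's inequality: the [b + 1] terms of index at most [b] are each at least [f b], and
     [b + 1 > e mu]. *)
  have : b.+1%:R * f b <= mu.
    apply: le_trans (sum_le b.+1).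
    apply: (@le_trans _ _ (\sum_(i < b.+1) f b)).
      by rewrite sumr_const card_ord mulr_natl.
    by apply: ler_sum => i _; apply: noncoal_nincr; rewrite -ltnS.
  move=> H; rewrite -[leRHS]mul1r ler_pdivlMr//.
  have := noncoal_ge0 b ord0 ord_max; rewrite -/b in bu; move: bu H.
  move: (f b) => z; move: (b.+1%:R) => B; nra.
have nb : f n <= f (n %/ b * b)%N by apply: noncoal_nincr; exact: leq_trunc_div.
apply: le_trans nb _; apply: le_trans (noncoal_mul_le _ _) _.
apply: (@le_trans _ _ ((expR 1)^-1 ^+ (n %/ b))).
  by apply: lerXn2r; rewrite // nnegrE ?noncoal_ge0// invr_ge0 ltW.
(* What remains is [n / (e mu) - 1 <= n %/ b], from [n < (n %/ b + 1) * b] and [b <= e mu]. *)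
rewrite -expRN -expRM_natl ler_expR mulrN1 ?mulr1.
rewrite lerBrDl -lerBrDr opprK ler_pdivrMr; last by lra.
have nlt : n%:R <= ((n %/ b).+1 * b)%:R :> R by rewrite ler_nat ltnW// ltn_ceil.
apply: le_trans nlt _; rewrite natrM -natr1 addrC.
by rewrite ler_wpM2l// addr_ge0.
Qed.

End NonCoalescence.

(** * Total probability over a finite-valued map, and the uniform law of an interval *)

Lemma measure_sum_fiber d (T : measurableType d) (R : realType)
    (P : {measure set T -> \bar R}) (F : finType) (B : set T) (v : T -> F) :
  measurable B -> (forall g, measurable (v @^-1` [set g])) ->
  P B = (\sum_g P (B `&` v @^-1` [set g]))%E.
Proof.
move=> mB mv.
have eB : B = \bigcup_(g in [set` index_enum F]) (B `&` v @^-1` [set g]).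
  apply/seteqP; split=> [w Bw|w [g _ []]//].
  by exists (v w) => //=; rewrite mem_index_enum.
rewrite {1}eB measure_fin_bigcup.
- by rewrite -fsbig_seq ?index_enum_uniq.
- exact: finite_seq.
- by move=> g h _ _ [w [[_ <-] [_ <-]]].
- by move=> g _; apply: measurableI.
Qed.

Lemma uniform_prob01_itvoo (R : realType) (a b : R) :
  0 <= a -> a <= b -> b <= 1 ->
  uniform_prob (@ltr01 R) `]a, b[ = (b - a)%:E.
Proof.
move=> a0 ab b1; rewrite /uniform_prob integral_uniform_pdf setIidl; last first.
  by move=> u /=; rewrite !in_itv /= => /andP[au ub]; apply/andP; split; lra.
rewrite (eq_integral (cst 1%E)); last first.
  move=> u; rewrite inE/= in_itv /uniform_pdf /= => /andP[au ub].
  by rewrite subr0 invr1 ifT//; apply/andP; split; lra.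
rewrite integral_cst//= mul1e lebesgue_measure_itv/= lte_fin.
by case: ltgtP ab => // ->; rewrite subrr.
Qed.

(** * One step of the chain: monotonicity and the law of the random map *)

Section Chain.
Context {R : realType} {N : nat}.
Variable pi : 'I_N.+1 -> R.
Hypothesis N_gt0 : (0 < N)%N.
Hypothesis pi_gt0 : forall i, 0 < pi i.
Local Notation gamma := (gamma pi).
Local Notation p := (p_up pi).
Local Notation q := (q_down pi).

Lemma gamma_gt0 i : 0 < gamma i.
Proof. by rewrite /Defs.gamma divr_gt0. Qed.

Lemma p_up_gt0 i : (i < N)%N -> 0 < p i.
Proof.
move=> iN; rewrite /p_up ltn_eqF//; have := gamma_gt0 i.
case: eqP => [->|_] g0; rewrite divr_gt0//; first by lra.
have gm : gamma i <= Num.max (gamma i) (gamma i.-1) by rewrite le_max lexx.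
by rewrite addr_gt0// (lt_le_trans g0).
Qed.

Lemma p_up_ge0 i : (i <= N)%N -> 0 <= p i.
Proof.
rewrite leq_eqVlt => /predU1P[->|/p_up_gt0/ltW//].
by rewrite /p_up eqxx.
Qed.

(** This is detailed balance between [i] and [i + 1], in the form used for all later
    computations. *)
Lemma q_downS i : (i < N)%N -> q i.+1 = gamma i * p i.
Proof.
move=> iN; rewrite /q_down /p_up /= (ltn_eqF iN).
by case: i iN => [|i] _ /=; rewrite mul1r.
Qed.

Lemma q_down_ge0 i : (i <= N)%N -> 0 <= q i.
Proof.
case: i => [|i] iN; first by rewrite /q_down.
by rewrite q_downS// mulr_ge0 ?p_up_ge0 ?(ltnW iN)// ltW// gamma_gt0.
Qed.

(** The maximum in [p_up] keeps both [p i] and [p i.+1] below [1 / (1 + gamma i)]. This first bound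
    gives monotonicity of [phi]; both together keep its up and down branches disjoint. *)
Lemma p_up_gamma i : (i < N)%N -> p i * (1 + gamma i) <= 1.
Proof.
move=> iN; rewrite /p_up ltn_eqF//; have g0 := gamma_gt0 i.
have gm : gamma i <= Num.max (gamma i) (gamma i.-1) by rewrite le_max lexx.
case: eqP => [i0|_]; rewrite mul1r mulrC ler_pdivrMr ?mul1r ?lerD2l//; last by lra.
  by rewrite i0.
by move: g0; rewrite i0; lra.
Qed.

Lemma p_upS_gamma i : p i.+1 * (1 + gamma i) <= 1.
Proof.
rewrite /p_up /=; have g0 := gamma_gt0 i.
have gm : gamma i <= Num.max (gamma i.+1) (gamma i) by rewrite le_max lexx orbT.
case: eqP => _; first by rewrite mul0r.
by rewrite mul1r mulrC ler_pdivrMr ?mul1r ?lerD2l//; lra.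
Qed.

Lemma p_up_le1 i : (i <= N)%N -> p i <= 1.
Proof.
rewrite leq_eqVlt => /predU1P[->|iN]; first by rewrite /p_up eqxx.
by have := p_up_gamma iN; have := gamma_gt0 i; have := p_up_gt0 iN; nra.
Qed.

(** Hence no single [u] moves [i] up and [i + 1] down, the only way in which neighbours could
    cross. *)
Lemma q_downS_le i : (i < N)%N -> q i.+1 <= 1 - p i.
Proof. by move=> iN; rewrite q_downS//; have := p_up_gamma iN; lra. Qed.

Lemma q_down_le i : (i <= N)%N -> q i <= 1 - p i.
Proof.
case: i => [|i] iN; first by rewrite {1}/q_down /= subr_ge0 p_up_le1.
rewrite q_downS//; have := p_up_gamma iN; have := p_upS_gamma i.
have := gamma_gt0 i; move: (gamma i) (p i) (p i.+1) => g a b g0 bg ag.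
by rewrite -(ler_pM2r (_ : 0 < 1 + g)); nra.
Qed.

(** The middle and default branches both fix [x], and merge because the down interval lies below the
    middle one; [p N = 0] empties the up branch at the top, so [inord] never overflows. *)
Lemma phiE (x : 'I_N.+1) u : (phi pi x u : nat) =
  if (1 - p x < u) && (u < 1) then x.+1
  else if (0 < u) && (u < q x) then x.-1 else x.
Proof.
have xN : (x <= N)%N by exact: leq_ord.
rewrite /phi !in_itv /=; have := q_down_le xN.
case: ifPn => [/andP[u1 u2] _|nup qp].
  rewrite inordK// ltnS ltn_neqAle xN andbT; apply/eqP => e; move: u1.
  by rewrite /p_up e eqxx; lra.
case: ifPn => [/andP[qu up]|nmid]; first by rewrite (le_gtF qu) andbF.
by case: ifPn => // _; rewrite inordK// (leq_ltn_trans (leq_pred _)).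
Qed.

(** Moves have size at most one, so the order is at risk only if [y = x + 1] and [x] goes up; then
    [y] does not go down. *)
Lemma phi_homo u (x y : 'I_N.+1) : (x <= y)%N -> (phi pi x u <= phi pi y u)%N.
Proof.
rewrite leq_eqVlt => /predU1P[/val_inj->//|xy].
have xN : (x < N)%N by rewrite (leq_trans xy)// leq_ord.
have y1 : (y.-1 <= phi pi y u)%N.
  by rewrite phiE; do 2?case: ifP => _;
    rewrite ?leq_pred// (leq_trans (leq_pred _)).
rewrite [X in (X <= _)%N]phiE; case: ifPn => [/andP[u1 u2]|_]; last first.
  by apply: leq_trans y1; case: ifP => _; lia.
have [e|xy1] := eqVneq (y : nat) x.+1; last by apply: leq_trans y1; lia.
rewrite -e phiE; case: ifP => // _; case: ifPn => // /andP[_ uq].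
by have := q_downS_le xN; rewrite -e; lra.
Qed.

Definition update (u : R) : {ffun 'I_N.+1 -> 'I_N.+1} := [ffun x => phi pi x u].

Lemma measurable_phi (x y : 'I_N.+1) : measurable [set u | phi pi x u = y].
Proof.
have mI (I : interval R) : measurable_fun setT (fun u => u \in I).
  apply: (measurable_fun_bool true); rewrite setTI.
  rewrite [X in measurable X](_ : _ = [set` I]); first exact: measurable_itv.
  by apply/seteqP; split=> u /=.
have mf : measurable_fun setT (fun u => phi pi x u == y).
  rewrite [X in measurable_fun _ X](_ : _ = fun u =>
    if u \in `](1 - p x), 1[ then inord x.+1 == y
    else if u \in `[q x, (1 - p x)] then x == y
    else if u \in `]0, (q x)[ then inord x.-1 == y else x == y).
    by do 3 (apply: measurable_fun_ifT => //).
  by apply/funext => u; rewrite /phi; do 3 case: ifP => _ //.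
have := mf measurableT [set true] I; rewrite setTI.
rewrite (_ : _ @^-1` _ = [set u | phi pi x u = y])//.
by apply/seteqP; split=> u /= /eqP.
Qed.

Lemma measurable_update g : measurable (update @^-1` [set g]).
Proof.
rewrite (_ : _ @^-1` _ = \bigcap_x [set u | phi pi x u = g x]).
  apply: fin_bigcap_measurable => //= x _; exact: measurable_phi.
apply/seteqP; split=> [u <- x _|u ug] /=; first by rewrite ffunE.
by apply/ffunP => x; rewrite ffunE ug.
Qed.

Definition law g : R := fine (uniform_prob (@ltr01 R) (update @^-1` [set g])).

Lemma lawE g : uniform_prob (@ltr01 R) (update @^-1` [set g]) = (law g)%:E.
Proof. by rewrite /law fineK// fin_num_measure//; exact: measurable_update. Qed.

Lemma law_ge0 g : 0 <= law g.
Proof. exact: fine_ge0. Qed.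

Lemma law_pred (Q : pred {ffun 'I_N.+1 -> 'I_N.+1}) (I : set R) :
  measurable I -> (forall u, Q (update u) <-> I u) ->
  (\sum_g law g * (Q g)%:R)%:E = uniform_prob (@ltr01 R) I.
Proof.
move=> mI QI; rewrite -sumEFin.
apply: etrans (esym
  (measure_sum_fiber (uniform_prob (@ltr01 R)) mI measurable_update)).
apply: eq_bigr => g _; case: (boolP (Q g)) => Qg.
  rewrite mulr1 -lawE; congr (uniform_prob _ _).
  apply/seteqP; split=> [u /= e|u []//].
  by split=> //; apply/QI; rewrite e.
rewrite mulr0 (_ : _ `&` _ = set0) ?measure0//; apply/seteqP; split=> u //= [Iu e].
by move: Qg; rewrite -e => /negP; apply; apply/QI.
Qed.

Lemma law_sum1 : \sum_g law g = 1.
Proof.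
apply: EFin_inj; rewrite -(@probability_setT _ _ _ (uniform_prob (@ltr01 R))).
apply: etrans (@law_pred xpredT setT measurableT _) => //.
by congr EFin; apply: eq_bigr => g _; rewrite mulr1.
Qed.

(** A fiber of nonzero mass is nonempty, so whatever holds of [update u] for every [u] passes to
    each map charged by [law]. *)
Lemma law_support g : law g != 0 -> exists u, update u = g.
Proof.
apply: contra_neqP => nu; rewrite /law (_ : _ @^-1` _ = set0) ?measure0//.
by apply/seteqP; split=> u //= e; apply: nu; exists u.
Qed.

Lemma law_mono g : law g != 0 -> {homo g : x y / (x <= y)%N}.
Proof. by move=> /law_support[u <-] x y xy; rewrite !ffunE phi_homo. Qed.

Lemma law_up x : \sum_g law g * ((g x : nat) == x.+1)%:R = p x.
Proof.
have xN : (x <= N)%N by exact: leq_ord.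
have [p0 p1] := (p_up_ge0 xN, p_up_le1 xN).
apply: EFin_inj; rewrite (@law_pred (fun g => (g x : nat) == x.+1) `](1 - p x), 1[)//.
  by rewrite uniform_prob01_itvoo; [congr EFin; lra|lra..].
move=> u; rewrite ffunE phiE /= in_itv /=; case: ifP => _; first by rewrite eqxx.
by case: ifP => _; split=> // /eqP; lia.
Qed.

(** A down move is encoded as [(g x).+1 == x], which is false at 0, whereas comparing with [x.-1]
    would count staying at 0. *)
Lemma law_down x : \sum_g law g * ((g x).+1 == x)%:R = q x.
Proof.
have xN : (x <= N)%N by exact: leq_ord.
have [[q0 q1] p0] := (q_down_ge0 xN, q_down_le xN, p_up_ge0 xN).
apply: EFin_inj; rewrite (@law_pred (fun g => (g x).+1 == x) `]0, q x[)//.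
  by rewrite uniform_prob01_itvoo; [congr EFin; lra|lra..].
move=> u; rewrite ffunE phiE /= in_itv /=; case: ifP => [/andP[u1 _]|_].
  by split=> [/eqP|/andP[_]]; [lia|lra].
case: ifP => [/andP[u0 uq]|_]; last by split=> // /eqP; lia.
split=> // _; have : (x : nat) != 0%N.
  by apply/eqP => x0; move: uq; rewrite x0 /q_down /=; lra.
by case: (x : nat) => //= n; rewrite eqxx.
Qed.

(** The generator of the birth-death chain acting on [h]; the identity holds map by map, with
    indicators of the up and down moves as weights. *)
Lemma law_drift (h : nat -> R) (x : 'I_N.+1) :
  \sum_g law g * h (g x) =
  h x + p x * (h x.+1 - h x) + q x * (h x.-1 - h x).
Proof.
have eh : h x = \sum_g law g * h x by rewrite -mulr_suml law_sum1 mul1r.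
rewrite -law_up -law_down [X in X + _ + _]eh !mulr_suml -!big_split /=.
apply: eq_bigr => g _; have [->|/law_support[u <-]] := eqVneq (law g) 0.
  by rewrite !mul0r !addr0.
rewrite -!mulrA -!mulrDr; congr (_ * _); rewrite ffunE phiE.
case: ifP => _.
  by rewrite eqxx (_ : (_ == _) = false) ?mulr1n ?mulr0n; [ring|lia].
case: ifP => [/andP[u0 uq]|_]; last first.
  have -> : (x == x.+1 :> nat) = false by lia.
  have -> : (x.+1 == x :> nat) = false by lia.
  by rewrite !mulr0n; ring.
have : (x : nat) != 0%N.
  by apply/eqP => x0; move: uq; rewrite x0 /q_down /=; lra.
case: (x : nat) => //= n _.
by rewrite eqxx (_ : (_ == _) = false) ?mulr1n ?mulr0n; [ring|lia].
Qed.

End Chain.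

(** * Mean hitting times of the birth-death chain and the constant [theta] *)

Section HittingTimes.
Context {R : realType} {N : nat}.
Variable pi : 'I_N.+1 -> R.
Hypothesis N_gt0 : (0 < N)%N.
Hypothesis pi_gt0 : forall i, 0 < pi i.

Let mass_le (i : nat) : R := \sum_(m < N.+1 | (m <= i)%N) pi m / pi (inord i).
Let mass_gt (i : nat) : R := \sum_(m < N.+1 | (i < m)%N) pi m / pi (inord i).
(** For [i < N] these are the mean passage times from [i] to [i + 1] and, below, from [i + 1] to
    [i]; by detailed balance both can be normalised by [pi i * p_up pi i]. *)
Let up_time (i : nat) : R := 1 / p_up pi i * mass_le i.
Let down_time (i : nat) : R := 1 / p_up pi i * mass_gt i.

(** Combined with detailed balance, this recurrence is the first-step equation of the passage
    times. *)
Let mass_leS i : (i < N)%N -> mass_le i.+1 = gamma pi i * mass_le i + 1.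
Proof.
move=> iN; rewrite /mass_le /gamma [LHS](bigD1 (inord i.+1)) ?inordK//=.
rewrite divff ?gt_eqF// addrC; congr (_ + _).
rewrite mulr_sumr; apply: eq_big => m.
  by rewrite -val_eqE /= inordK// [in RHS]leq_eqVlt; lia.
by move=> _; field; rewrite !gt_eqF.
Qed.

Let mass_gtS i : (i < N)%N -> gamma pi i * mass_gt i = mass_gt i.+1 + 1.
Proof.
move=> iN; rewrite /mass_gt /gamma [in LHS](bigD1 (inord i.+1)) ?inordK//=.
rewrite mulrDr addrC; congr (_ + _); last by field; rewrite !gt_eqF.
rewrite mulr_sumr; apply: eq_big => m.
  by rewrite -val_eqE /= inordK//; lia.
by move=> _; field; rewrite !gt_eqF.
Qed.

Let mass_gtN : mass_gt N = 0.
Proof. by apply: big_pred0 => m; have := ltn_ord m; lia. Qed.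

Let p_up_time i : (i < N)%N -> p_up pi i * up_time i = mass_le i.
Proof.
by move=> iN; rewrite /up_time mulrA mulrC mul1r divff ?mulr1// gt_eqF// p_up_gt0.
Qed.

Let p_down_time i : (i <= N)%N -> p_up pi i * down_time i = mass_gt i.
Proof.
(* The case [i = N] serves the drift of [hit_bot] from the top state. *)
rewrite leq_eqVlt => /predU1P[->|iN]; first by rewrite mass_gtN /p_up eqxx mul0r.
by rewrite /down_time mulrA mulrC mul1r divff ?mulr1// gt_eqF// p_up_gt0.
Qed.

Let mass_le_ge0 i : 0 <= mass_le i.
Proof. by apply: sumr_ge0 => m _; rewrite divr_ge0// ltW. Qed.

Let mass_gt_ge0 i : 0 <= mass_gt i.
Proof. by apply: sumr_ge0 => m _; rewrite divr_ge0// ltW. Qed.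

Let up_time_ge0 i : (i <= N)%N -> 0 <= up_time i.
Proof. by move=> iN; rewrite /up_time mulr_ge0// divr_ge0// p_up_ge0. Qed.

Let down_time_ge0 i : (i <= N)%N -> 0 <= down_time i.
Proof. by move=> iN; rewrite /down_time mulr_ge0// divr_ge0// p_up_ge0. Qed.

(* The mean hitting times of N and of 0 from [x]. *)
Let hit_top (x : nat) : R := \sum_(x <= i < N) up_time i.
Let hit_bot (x : nat) : R := \sum_(0 <= i < x) down_time i.

(** The up and down increments contribute [- mass_le x] and [gamma pi x.-1 * mass_le x.-1], which
    sum to -1 by the recurrence; at 0 only [- mass_le 0 = - 1] is left. The drift of [hit_bot] is
    the mirror image. *)
Let hit_top_drift (x : 'I_N.+1) : (x < N)%N ->
  \sum_g law pi g * hit_top (g x) = hit_top x - 1.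
Proof.
move=> xN; rewrite law_drift//.
have -> : hit_top x.+1 - hit_top x = - up_time x.
  by rewrite /hit_top [X in _ - X]big_ltn//; ring.
rewrite mulrN p_up_time//; move: xN; case: (x : nat) => [|i] iN.
  rewrite {1}/q_down /= mul0r addr0 /mass_le (bigD1 ord0)//=.
  rewrite big1 ?addr0 => [|m]; last by rewrite -val_eqE /=; lia.
  rewrite (_ : inord 0 = ord0) ?divff ?gt_eqF//.
  by apply: val_inj; rewrite /= inordK.
have -> : hit_top i.+1.-1 - hit_top i.+1 = up_time i.
  by rewrite /hit_top /= big_ltn 1?ltnW//; ring.
have iN' : (i < N)%N by rewrite ltnW.
rewrite q_downS// -mulrA p_up_time// mass_leS//; ring.
Qed.

Let hit_bot_drift (y : 'I_N.+1) : (0 < y)%N ->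
  \sum_g law pi g * hit_bot (g y) = hit_bot y - 1.
Proof.
move=> y0; have := leq_ord y; rewrite law_drift//.
have -> : hit_bot y.+1 - hit_bot y = down_time y.
  by rewrite /hit_bot big_nat_recr//=; ring.
move: y0; case: (y : nat) => // i _ iN.
have -> : hit_bot i.+1.-1 - hit_bot i.+1 = - down_time i.
  by rewrite /hit_bot /= big_nat_recr//=; ring.
rewrite p_down_time// q_downS// mulrN -mulrA p_down_time 1?ltnW//.
by rewrite mass_gtS//; ring.
Qed.

Let le_max_up i : (i < N)%N -> up_time i <=
  \big[Num.max/0]_(i < N.+1 | (i < N)%N)
       (1 / p_up pi i * \sum_(m < N.+1 | (m <= i)%N) pi m / pi i).
Proof.
move=> iN.
have := @le_bigmax_cond _ _ _ 0 (inord i) (fun i : 'I_N.+1 => (i < N)%N)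
  (fun i : 'I_N.+1 => 1 / p_up pi i * \sum_(m < N.+1 | (m <= i)%N) pi m / pi i).
by rewrite (inordK (ltnW iN : (i < N.+1)%N)); apply.
Qed.

Let le_max_down i : (i < N)%N -> down_time i <=
  \big[Num.max/0]_(i < N.+1 | (i < N)%N)
       (1 / p_up pi i * \sum_(m < N.+1 | (i < m)%N) pi m / pi i).
Proof.
move=> iN.
have := @le_bigmax_cond _ _ _ 0 (inord i) (fun i : 'I_N.+1 => (i < N)%N)
  (fun i : 'I_N.+1 => 1 / p_up pi i * \sum_(m < N.+1 | (i < m)%N) pi m / pi i).
by rewrite (inordK (ltnW iN : (i < N.+1)%N)); apply.
Qed.

(** As long as [x < y], the lower copy is below [N] and the upper one above 0, so either hitting
    time is a valid Lyapunov function; each yields one side of the minimum in [theta]. *)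
Lemma sum_noncoal_theta M :
  \sum_(n < M) noncoal (law pi) n ord0 ord_max <= theta pi * N%:R.
Proof.
have bound c (F : nat -> R) : (forall i, (i < N)%N -> F i <= c) ->
    \sum_(0 <= i < N) F i <= c * N%:R.
  move=> Fc; rewrite big_mkord mulr_natr -[leRHS](_ : \sum_(i < N) c = _).
    by apply: ler_sum => i _; apply: Fc.
  by rewrite sumr_const card_ord.
have mono := law_mono N_gt0 pi_gt0.
have ge0 := law_ge0 pi.
rewrite /theta minr_pMl// le_min; apply/andP; split.
  apply: le_trans (bound _ _ le_max_up).
  apply: (@sum_noncoal_le _ _ (law pi) ge0 mono (fun x _ => hit_top x)) => //.
    move=> x _; rewrite /hit_top big_nat_cond; apply: sumr_ge0 => i.
    by rewrite andbT => /andP[_ iN]; rewrite up_time_ge0// ltnW.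
  by move=> x y xy; rewrite hit_top_drift// (leq_trans xy)// leq_ord.
apply: le_trans (bound _ _ le_max_down).
apply: (@sum_noncoal_le _ _ (law pi) ge0 mono (fun _ y => hit_bot y)
  _ _ M ord0 ord_max) => //.
  move=> _ y; rewrite /hit_bot big_nat_cond; apply: sumr_ge0 => i.
  rewrite andbT => /andP[_ iy]; rewrite down_time_ge0// ltnW//.
  by rewrite (leq_trans iy)// leq_ord.
by move=> x y xy; rewrite hit_bot_drift// (leq_ltn_trans _ xy).
Qed.

End HittingTimes.

(** * The running time along a fixed innovation sequence, through its window events *)

Lemma sum_doubling (R : realType) J :
  2 + \sum_(0 <= j < J) 2 ^+ j.+1 = 2 ^+ J.+1 :> R.
Proof.
elim: J => [|J IH]; first by rewrite big_geq// addr0 expr1.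
by rewrite big_nat_recr//= addrA IH [RHS]exprS; ring.
Qed.

Section RunningTime.
Context {R : realType} {N : nat}.
Variable pi : 'I_N.+1 -> R.
Implicit Types u : int -> R.

Definition separated u (m : int) n (x y : 'I_N.+1) : bool :=
  Phi pi x u m n != Phi pi y u m n.

Definition missed u j : bool :=
  separated u (- (2 ^ j.+1)%N%:Z) (2 ^ j)%N ord0 ord_max.

Lemma coalescesE u j : coalesces pi u (2 ^ j.+1)%N <-> ~~ missed u j.
Proof.
rewrite /coalesces /missed /separated negbK (_ : (2 ^ j.+1)./2 = 2 ^ j)%N.
  by split=> /eqP.
by rewrite expnS mul2n doubleK.
Qed.

Lemma T_D_le u j : ~~ missed u j -> (T_D pi u <= (2 ^+ j.+1)%:E)%E.
Proof.
move=> /coalescesE c; apply: ereal_inf_lbound; exists (2 ^ j.+1)%N.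
  by split=> //; exists j.
by rewrite natrX.
Qed.

Lemma T_D_cases u :
  (T_D pi u = +oo%E /\ forall j, missed u j) \/
  exists j, [/\ T_D pi u = (2 ^+ j.+1)%:E, ~~ missed u j &
                forall i, (i < j)%N -> missed u i].
Proof.
have [H|H] := pselect (forall j, missed u j); [left|right].
  split=> //; apply/ereal_inf_pinfty => y [t [[j tj] ct] _].
  by move: ct; rewrite tj => /coalescesE; rewrite H.
have exj : exists j, ~~ missed u j.
  by apply: contra_notP H => nex j; apply: contra_notT nex => nj; exists j.
case: (ex_minnP exj) => j cj jmin; exists j; split=> //; last first.
  by move=> i ij; apply: contraTT ij => /jmin; rewrite leqNgt.
apply/eqP; rewrite eq_le T_D_le//=.
apply/ereal_infP => y [t [[i ti] ct] <-]; move: ct; rewrite ti => /coalescesE ci.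
by rewrite lee_fin -natrX ler_nat leq_exp2l// ltnS jmin.
Qed.

(** Reduces exceedance to countably many window events, for measurability and for the tail bound. *)
Lemma T_D_gt u (c : R) :
  (c%:E < T_D pi u)%E <-> forall j, 2 ^+ j.+1 <= c -> missed u j.
Proof.
split=> [cT j jc|H].
  apply: contraLR cT => /T_D_le Tj.
  by rewrite -leNgt (le_trans Tj)// lee_fin.
case: (T_D_cases u) => [[-> _]|[j [-> cj _]]]; first exact: ltry.
by rewrite lte_fin ltNge; apply: contra cj => /H.
Qed.

Lemma T_D_ge0 u : (0 <= T_D pi u)%E.
Proof. by apply/ereal_infP => _ [t _ <-]; rewrite lee_fin. Qed.

(** All windows before the successful one fail, and the doublings telescope by [sum_doubling]. Only
    an inequality holds, since windows after it may fail too. *)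
Lemma T_D_le_series u :
  (T_D pi u <=
   (2 : R)%:E + \sum_(0 <= j <oo) (2 ^+ j.+1 * (missed u j)%:R : R)%:E)%E.
Proof.
have partial k : (forall j, (j < k)%N -> missed u j) ->
    ((2 ^+ k.+1 : R)%:E <=
     (2 : R)%:E + \sum_(0 <= j <oo) (2 ^+ j.+1 * (missed u j)%:R : R)%:E)%E.
  move=> mk; rewrite -(sum_doubling R) EFinD leeD2l//.
  apply: le_trans (nneseries_lim_ge k _); last first.
    by move=> n _ _; rewrite lee_fin mulr_ge0.
  rewrite sumEFin lee_fin le_eqVlt; apply/predU1P; left.
  by apply: eq_big_nat => j /andP[_ /mk ->]; rewrite mulr1.
case: (T_D_cases u) => [[-> all]|[j [-> _ mj]]]; last exact: partial.
(* If every window fails, the partial bounds are unbounded: [2 ^ k.+1] exceeds [A] for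
   [k = truncn A]. *)
rewrite [X in (_ <= X)%E](_ : _ = +oo%E)//; apply/eqyP => A A0.
apply: le_trans (partial (Num.truncn A) (fun j _ => all j)).
rewrite lee_fin ltW// (lt_le_trans (truncnS_gt A))// -natrX ler_nat.
by rewrite ltnW// ltn_expl.
Qed.

(** * Probabilities of window events, by independence *)

Section Law.
Context d (T : measurableType d) (P : probability T R).
Variable U : int -> {RV P >-> R}.
Hypothesis N_gt0 : (0 < N)%N.
Hypothesis pi_gt0 : forall i, 0 < pi i.
Hypothesis hU : iid_uniform01 U.
Local Notation path w := (fun m : int => U m w).

Lemma separatedS u m n x y : separated u m n.+1 x y =
  separated u (m + 1) n (update pi (u m) x) (update pi (u m) y).
Proof.
have step z : Phi pi z u m n.+1 = Phi pi (update pi (u m) z) u (m + 1) n.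
  rewrite /Phi /= addr0 ffunE; congr foldl.
  rewrite -[1%N]addn0 iotaDl -map_comp; apply: eq_map => k /=.
  by rewrite -addrA -PoszD.
by rewrite /separated !step.
Qed.

Let measurable_fiber m g : measurable [set w | update pi (U m w) = g].
Proof. exact: (measurable_funPTI (U m) (measurable_update pi g)). Qed.

Lemma measurable_separated m n x y :
  measurable [set w | separated (path w) m n x y].
Proof.
elim: n m x y => [|n IH] m x y.
  have [e|e] := eqVneq x y.
    rewrite [X in measurable X](_ : _ = set0)//; apply/seteqP; split=> w //=.
    by rewrite /separated /Phi /= e eqxx.
  rewrite [X in measurable X](_ : _ = setT)//; apply/seteqP; split=> w //= _.
rewrite [X in measurable X](_ : _ =
  \bigcup_g ([set w | update pi (U m w) = g] `&`
             [set w | separated (path w) (m + 1) n (g x) (g y)])).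
  by apply: fin_bigcup_measurable => // g _; apply: measurableI.
apply/seteqP; split=> [w /=|w [g _ [/= <-]]]; rewrite separatedS// => s.
by exists (update pi (U m w)).
Qed.

(* The prefix [J, A] records the innovations already used, so that the
   induction on [n] can peel off [U m] by independence. *)
Lemma prob_prefix_separated n m x y (J : seq int) (A : int -> set R) :
  uniq J -> (forall i, i \in J -> i < m) ->
  (forall i, i \in J -> measurable (A i)) ->
  P (\bigcap_(i in [set` J]) U i @^-1` A i `&`
     [set w | separated (path w) m n x y]) =
  (\prod_(i <- J) P (U i @^-1` A i) * (noncoal (law pi) n x y)%:E)%E.
Proof.
elim: n m x y J A => [|n IH] m x y J A uJ Jm mA.
  have [ind _] := hU; rewrite noncoal0.
  have [e|e] := eqVneq x y.
    rewrite mule0 (_ : _ `&` _ = set0) ?measure0//; apply/seteqP; split=> w //=.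
    by rewrite /separated /Phi /= e eqxx => -[].
  rewrite mule1 -ind//; congr (P _); apply/seteqP; split=> w; first by case.
  by split.
rewrite (measure_sum_fiber P (v := fun w => update pi (U m w))); last 2 first.
- apply: measurableI; last exact: measurable_separated.
  by apply: fin_bigcap_measurable => // i iJ; apply: measurable_funPTI; apply: mA.
- by move=> g; apply: measurable_fiber.
rewrite noncoalS -sumEFin ge0_sume_distrr; last first.
  move=> g _; rewrite lee_fin mulr_ge0 ?law_ge0// noncoal_ge0//.
  exact: law_ge0.
apply: eq_bigr => g _.
(* The prefix is extended by [m], constrained to the fiber of [g]; [m] is new because all of [J]
   lies below it. *)
pose A' i := if i == m then update pi @^-1` [set g] else A i.
have A'm : A' m = update pi @^-1` [set g] by rewrite /A' eqxx.
have mJ : m \notin J by apply/negP => /Jm; rewrite ltxx.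
have A'J i : i \in J -> A' i = A i.
  by move=> iJ; rewrite /A'; case: eqP => // im; rewrite -im iJ in mJ.
have := IH (m + 1) (g x) (g y) (m :: J) A'.
rewrite cons_uniq mJ uJ big_cons A'm.
rewrite (eq_big_seq (fun i => P (U i @^-1` A i))); last first.
  by move=> i /A'J ->.
have -> : P (U m @^-1` (update pi @^-1` [set g])) = (law pi g)%:E.
  have [_ /(_ m _ (measurable_update pi g))] := hU.
  by rewrite lawE.
rewrite (_ : \bigcap_(i in _) _ `&` _ =
    \bigcap_(i in [set` J]) U i @^-1` A i `&`
    [set w | separated (path w) m n.+1 x y] `&`
    (fun w => update pi (U m w)) @^-1` [set g]).
  move=> IHg; apply: (etrans (IHg isT _ _)).
  - move=> i; rewrite inE => /predU1P[->|/Jm im]; first by rewrite ltrDl.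
    by rewrite (lt_trans im)// ltrDl.
  - move=> i; rewrite inE /A' => /predU1P[->|iJ].
      by rewrite eqxx; exact: measurable_update.
    by case: eqP => _; [exact: measurable_update|exact: mA].
  - by rewrite EFinM muleA [X in (X * _)%E]muleC.
apply/seteqP; split=> w /=.
  move=> [HA s].
  have := HA m; rewrite /= mem_head A'm => /(_ isT) /= um.
  split=> //; split; last by rewrite separatedS um.
  by move=> i /= iJ; have := HA i; rewrite /= inE iJ orbT A'J//; apply.
move=> [[HA]]; rewrite separatedS => + um; rewrite um => s; split=> //.
move=> i /=; rewrite inE => /predU1P[->|iJ]; first by rewrite A'm.
by rewrite A'J//; apply: HA.
Qed.

Lemma prob_separated m n x y :
  P [set w | separated (path w) m n x y] = (noncoal (law pi) n x y)%:E.
Proof.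
have := @prob_prefix_separated n m x y [::] (fun=> setT) isT.
rewrite big_nil mul1e => <- //; congr (P _).
by apply/seteqP; split=> w /=; [split|case].
Qed.

(** * Measurability, mean and tail of the running time *)

Let f n := noncoal (law pi) n ord0 ord_max.

Lemma measurable_missed j : measurable [set w | missed (path w) j].
Proof. exact: measurable_separated. Qed.

Lemma prob_missed j : P [set w | missed (path w) j] = (f (2 ^ j))%:E.
Proof. exact: prob_separated. Qed.

Lemma measurable_T_D_gt (c : R) :
  measurable [set w | (c%:E < T_D pi (path w))%E].
Proof.
rewrite [X in measurable X](_ : _ =
  \bigcap_j [set w | 2 ^+ j.+1 <= c -> missed (path w) j]).
  apply: bigcapT_measurable => j; have [jc|jc] := boolP (2 ^+ j.+1 <= c).
    rewrite [X in measurable X](_ : _ = [set w | missed (path w) j]).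
      exact: measurable_missed.
    by apply/seteqP; split=> w /= => [/(_ isT)|].
  by rewrite [X in measurable X](_ : _ = setT)//; apply/seteqP; split.
apply/seteqP; split=> w /= => [/T_D_gt H j _|H]; first exact: H.
by apply/T_D_gt => j; apply: H.
Qed.

Lemma measurable_T_D : measurable_fun setT (fun w => T_D pi (path w)).
Proof.
move=> mT; apply: (measurability _ (ErealGenOInfty.measurableE R)) => //.
move=> /= _ [_ [c ->] <-]; rewrite setTI.
rewrite [X in measurable X](_ : _ = [set w | (c%:E < T_D pi (path w))%E]).
  exact: measurable_T_D_gt.
by apply/seteqP; split=> w /=; rewrite in_itv/= andbT.
Qed.

(** The series bound is integrated term by term, and each partial sum is controlled by
    [sum_dyadic_noncoal]. *)
Lemma expectation_T_D :
  (\int[P]_w T_D pi (path w) <= (4 * theta pi * N%:R)%:E)%E.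
Proof.
pose F j w : \bar R := (2 ^+ j.+1 * (missed (path w) j)%:R)%:E.
have F0 j w : (0 <= F j w)%E by rewrite lee_fin mulr_ge0.
have FE j : F j = (fun w => (2 ^+ j.+1)%:E *
    (\1_[set w | missed (path w) j] w)%:E)%E.
  apply/funext => w; rewrite /F indicE -EFinM; congr (_ * _%:R)%:E.
  by congr nat_of_bool; apply/idP/idP => [h|/set_mem//]; rewrite inE.
have mI j : measurable_fun setT
    (fun w => (\1_[set w | missed (path w) j] w)%:E : \bar R).
  by apply/measurable_EFinP; apply: measurable_indic; exact: measurable_missed.
have mF j : measurable_fun setT (F j).
  by rewrite FE; apply: measurable_funeM.
have IF j : (\int[P]_w F j w = (2 ^+ j.+1 * f (2 ^ j))%:E)%E.
  rewrite FE ge0_integralZl// ?lee_fin ?exprn_ge0//.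
  rewrite integral_indic//; last exact: measurable_missed.
  by rewrite setIT EFinM; congr (_ * _)%E; exact: prob_missed.
apply: (@le_trans _ _ (\int[P]_w (cst 2%:E w + \sum_(0 <= j <oo) F j w))%E).
  apply: ge0_le_integral => //; first by move=> w _; exact: T_D_ge0.
  - exact: measurable_T_D.
  - apply: emeasurable_funD => //.
    exact: (@ge0_emeasurable_sum _ _ _ _ _ xpredT).
  - by move=> w _; apply: T_D_le_series.
rewrite ge0_integralD//; last 3 first.
- by move=> w _; rewrite lee_fin.
- by move=> w _; apply: nneseries_ge0.
- exact: (@ge0_emeasurable_sum _ _ _ _ _ xpredT).
rewrite integral_cst// [X in (_ * X)%E](probability_setT P) mule1.
rewrite integral_nneseries//.
rewrite -leeBrDl//; apply: lime_le.
  by apply: is_cvg_nneseries => j _ _; apply: integral_ge0.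
apply: nearW => J; rewrite leeBrDl// (eq_bigr _ (fun j _ => IF j)).
rewrite sumEFin -EFinD lee_fin big_mkord -mulrA.
apply: sum_dyadic_noncoal => //; first exact: law_ge0.
- exact: law_sum1.
- exact: law_mono.
- exact: sum_noncoal_theta.
Qed.

(** For the largest [j] with [2 ^ j.+1 <= k mu], exceedance forces window [j] to fail; its length is
    at least [k mu / 4], whence the 4 in the exponent. *)
Lemma prob_T_D_gt (k : nat) :
  (P [set w | ((k%:R * theta pi * N%:R)%:E < T_D pi (path w))%E] <=
      (expR (1 - k%:R / (4 * expR 1)))%:E)%E.
Proof.
set mu := theta pi * N%:R; rewrite -mulrA -/mu.
have e1 : 1 <= expR 1 :> R by rewrite ltW// expR_gt1.
have smu := sum_noncoal_theta N_gt0 pi_gt0; rewrite -/mu in smu.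
have mu1 : 1 <= mu.
  have := smu 1; rewrite big_ord_recl big_ord0 addr0 noncoal0.
  by rewrite -val_eqE /= eq_sym -lt0n N_gt0.
(* Below 2 no such [j] exists, but then [k <= k mu < 2 < 4 e] and the claimed bound is at least
   1. *)
have [c2|c2] := ltP (k%:R * mu) 2.
  apply: le_trans (probability_le1 _ (measurable_T_D_gt _)) _.
  rewrite lee_fin -[leLHS]expR0 ler_expR subr_ge0 ler_pdivrMr; last by lra.
  by have := ler0n R k; nra.
pose n := Num.truncn (k%:R * mu).
have /andP[nl nu] := truncn_itv (le_trans (ler0n R 2) c2).
have n2 : (2 <= n)%N by rewrite truncn_ge_nat// (le_trans _ c2).
(* As [n >= 2], the logarithm is positive and can be written [j.+1]. *)
have /andP[jn nj] := @trunc_log_bounds 2 n isT (ltnW n2).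
have : (0 < trunc_log 2 n)%N by rewrite trunc_log_gt0.
move: jn nj; case: (trunc_log 2 n) => // j jn nj _.
have jc : 2 ^+ j.+1 <= k%:R * mu.
  by apply: le_trans nl; rewrite -natrX ler_nat.
have cj : k%:R * mu <= 4 * 2 ^+ j.
  apply: le_trans (ltW nu) _; rewrite -natrX -natrM ler_nat.
  by rewrite -(expnD 2 2 j).
apply: (@le_trans _ _ (P [set w | missed (path w) j])).
  apply: le_measure; rewrite ?inE;
    [exact: measurable_T_D_gt|exact: measurable_missed|].
  by move=> w /= /T_D_gt; apply.
rewrite prob_missed lee_fin.
apply: le_trans (noncoal_expR (law_ge0 pi) (law_sum1 pi)
  (law_mono N_gt0 pi_gt0) smu _ N_gt0) _.
rewrite ler_expR lerD2l lerN2 natrX ler_pdivrMr; last by lra.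
rewrite mulrAC ler_pdivlMr; last by nra.
nra.
Qed.

End Law.
End RunningTime.

Unset Implicit Arguments.

Theorem proposition3p1 (R : realType) (N : nat) (hN : (0 < N)%N)
  (pi : 'I_N.+1 -> R)
  (pi_gt0 : forall i : 'I_N.+1, 0 < pi i)
  (pi_sum1 : \sum_(i < N.+1) pi i = 1)
  (d : measure_display) (T : measurableType d) (P : probability T R)
  (U : int -> {RV P >-> R})
  (hU : iid_uniform01 U) :
  let TD (w : T) : \bar R := T_D pi (fun m : int => U m w) in
  (\int[P]_w TD w <= (4 * theta pi * N%:R)%:E)%E /\
  (forall k : nat,
     (P [set w | ((k%:R * theta pi * N%:R)%:E < TD w)%E] <=
      (expR (1 - k%:R / (4 * expR 1)))%:E)%E).
Proof.
move=> TD; split; first exact: expectation_T_D.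
exact: prob_T_D_gt.
Qed.
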